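(* Let $\alpha$ be a countable ordinal and let $A\subseteq X_\alpha$. Then $A$ is a Banach-Saks set if and only if $\mathrm{conv}(A)$ is a Banach-Saks set.
   Context: A subset $A$ of a Banach space is a Banach-Saks set if every sequence in $A$ has a subsequence whose Ces\`aro means converge in norm. For a family $\mathcal F$ of finite subsets of $\mathbb N$, $X_{\mathcal F}$ is the completion of $c_{00}(\mathbb N)$ under $\|x\|_{\mathcal F}=\max\{\|x\|_\infty,\sup_{s\in\mathcal F}\sum_{n\in s}|(x)_n|\}$. The Schreier family is $\mathcal S=\{s\subseteq\mathbb N: \#s\le\min s\}$. For families $\mathcal F,\mathcal G$, $\mathcal F\otimes\mathcal G=\{s_0\cup\dots\cup s_n: s_0<\dots<s_n \text{ in }\mathcal F,\ \{\min s_i\}_{i\le n}\in\mathcal G\}$, where $s<t$ means $\max s<\min t$. For each countable limit ordinal $\alpha$ fix a strictly increasing sequence $(\beta_n^{(\alpha)})_n$ with supremum $\alpha$. The generalized Schreier families are defined by $\mathcal S_0=\{s\subseteq\mathbb N:\#s\le1\}$, $\mathcal S_{\alpha+1}=\mathcal S_\alpha\otimes\mathcal S$, and for limit $\alpha$, $\mathcal S_\alpha=\bigcup_n\{s\in\mathcal S_{\beta_n^{(\alpha)}}: s\subseteq[n+1,\infty)\}$. Then $X_\alpha:=X_{\mathcal S_\alpha}$. *)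

(* Defs.v *)
From mathcomp Require Import all_boot all_order all_algebra.
From mathcomp Require Import reals.
Set Implicit Arguments. Unset Strict Implicit. Unset Printing Implicit Defensive.
Import Order.TTheory GRing.Theory Num.Theory.
Local Open Scope ring_scope.

(* Convention: the paper's N = {1,2,3,...}.  Finite subsets of N are represented
   by strictly increasing lists (sorted ltn) of positive naturals; a family of
   finite subsets is a predicate on such lists.  A vector x : nat -> R stores the
   paper's coordinate (x)_n (n >= 1) at index n.-1. *)

Definition family := seq nat -> Prop.

Definition S0 : family := fun s => (size s <= 1)%N.

Definition schreier : family := fun s => forall n, n \in s -> (size s <= n)%N.

(* F (x) G = { s_0 u ... u s_k : s_0 < ... < s_k in F, {min s_i}_i in G }.
   With sorted-list representation: s is the concatenation of nonempty blocks
   s_0,...,s_k (consecutive, since s is strictly increasing), each in F, and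
   the list of their minima (heads) is in G. *)
Definition tensor (F G : family) : family := fun s =>
  exists ss : seq (seq nat),
    ss != [::] /\
    [/\ all (fun t => t != [::]) ss, (forall t, t \in ss -> F t),
        s = flatten ss, sorted ltn s & G (map (head 0%N) ss)].

(* Brouwer trees: countable ordinals together with the chosen fundamental
   sequences at limit nodes. *)
Inductive bord : Type :=
| BZ : bord
| BS : bord -> bord
| BL : (nat -> bord) -> bord.

Inductive ble : bord -> bord -> Prop :=
| ble_zero x : ble BZ x
| ble_trans x y z : ble x y -> ble y z -> ble x z
| ble_succ x y : ble x y -> ble (BS x) (BS y)
| ble_cocone x f k : ble x (f k) -> ble x (BL f)
| ble_limiting f x : (forall k, ble (f k) x) -> ble (BL f) x.

Definition blt (x y : bord) : Prop := ble (BS x) y.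

(* Valid trees: at every limit node the fundamental sequence is strictly
   increasing (its supremum is then the limit ordinal denoted by the node). *)
Inductive valid_bord : bord -> Prop :=
| valid_Z : valid_bord BZ
| valid_S x : valid_bord x -> valid_bord (BS x)
| valid_L f : (forall n, valid_bord (f n)) -> (forall n, blt (f n) (f n.+1)) ->
              valid_bord (BL f).

(* Generalized Schreier families.  f n is the paper's beta_{n+1}, so the
   condition s subset [ (n+1)+1, oo ) reads: every element k of s has n.+2 <= k. *)
Fixpoint gschreier (a : bord) : family :=
  match a with
  | BZ => S0
  | BS b => tensor (gschreier b) schreier
  | BL f => fun s => exists n, gschreier (f n) s /\ all (fun k => n.+2 <= k)%N s
  end.

Section Space.
Variable R : realType.

Definition normF_le (F : family) (x : nat -> R) (c : R) : Prop :=
  (forall k, `|x k| <= c) /\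
  (forall s, sorted ltn s -> all (fun n => 0 < n)%N s -> F s ->
     \sum_(n <- s) `|x n.-1| <= c).

Definition finsupp (y : nat -> R) : Prop := exists N, forall k, (N <= k)%N -> y k = 0.

(* X_F: the completion of c00 under ||.||_F, realized as the closure of c00 in
   the (complete) space of all sequences of finite F-norm. *)
Definition inX (F : family) (x : nat -> R) : Prop :=
  forall e : R, 0 < e -> exists y, finsupp y /\ normF_le F (fun k => x k - y k) e.

Definition cesaro (u : nat -> nat -> R) (phi : nat -> nat) (k : nat) : nat -> R :=
  fun j => (k.+1)%:R^-1 * \sum_(i < k.+1) u (phi i) j.

Definition banach_saks (F : family) (A : (nat -> R) -> Prop) : Prop :=
  forall u : nat -> nat -> R, (forall k, A (u k)) ->
  exists phi : nat -> nat, (forall i, (phi i < phi i.+1)%N) /\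
    exists y, inX F y /\
      forall e : R, 0 < e -> exists N, forall k, (N <= k)%N ->
        normF_le F (fun j => cesaro u phi k j - y j) e.

Definition conv (A : (nat -> R) -> Prop) : (nat -> R) -> Prop := fun x =>
  exists (n : nat) (a : 'I_n -> nat -> R) (w : 'I_n -> R),
    [/\ (forall i, A (a i)), (forall i, 0 <= w i), \sum_i w i = 1 &
        x = (fun j => \sum_i w i * a i j)].

End Space.

(* Main.v *)
(** Along a free ultrafilter U, means u_n of points of A converge coordinatewise
    to some x.  If the tails of x did not vanish, Ptak's combinatorial lemma would
    give points of A that are simultaneously large on arbitrarily many far-out
    members of S_alpha, and the Cesaro limit of such points could not lie in
    X_alpha.  If G (x) S is contained in S_alpha up to finitely many integers, then
    u_n - x tends to 0 along U in the norm of G: otherwise, since an l1-norm on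
    a fixed finite set is convex, some points of A would themselves be large on
    successive blocks of G, and unions of k such blocks lying beyond k would bound
    their Cesaro means from below.  Hence the mass of u_n - x on members of
    S_alpha whose minimum is at most M tends to 0 for each M, so u_n has
    a subsequence for which every member of S_alpha sees essentially one term
    of u_n - x. *)
From mathcomp Require Import boolp classical_sets filter reals.
From mathcomp Require Import all_boot all_order all_algebra.
From mathcomp Require Import zify ring lra.
Require Import Defs.
Set Implicit Arguments. Unset Strict Implicit. Unset Printing Implicit Defensive.
Import Order.TTheory GRing.Theory Num.Theory.
Local Open Scope ring_scope.

(** * Norming sets *)


Definition posset (s : seq nat) : bool := sorted ltn s && all (fun n => 0 < n)%N s.

(** Admitting all singletons absorbs the sup-norm half of [normF_le], so the norm becomes a single
    supremum over these sets. *)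
Definition norming (F : family) (s : seq nat) : Prop :=
  [/\ posset s, s != [::] & F s \/ size s = 1%N].

(** The empty result is excluded because [tensor] never contains the empty list. *)
Definition hereditary (F : family) : Prop := forall (p : pred nat) s,
  sorted ltn s -> F s -> filter p s != [::] -> F (filter p s).

Definition sumabs (R : realType) (s : seq nat) (x : nat -> R) : R :=
  \sum_(n <- s) `|x n.-1|.

Lemma posset_filter p s : posset s -> posset (filter p s).
Proof.
case/andP=> so pos; apply/andP; split; first exact: sorted_filter ltn_trans _ _ so.
by rewrite all_filter; apply: sub_all pos => n /= ->; rewrite implybT.
Qed.

Lemma norming_filter F p s : hereditary F -> norming F s ->
  filter p s != [::] -> norming F (filter p s).
Proof.
move=> hF [ps sn0 Fs] fn0; split; [exact: posset_filter | exact: fn0 |].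
case: Fs => [Fs|s1]; first by left; apply: hF => //; case/andP: ps.
right; apply/eqP; rewrite eqn_leq -{1}s1 size_filter count_size /=.
by rewrite -size_filter lt0n size_eq0.
Qed.

Lemma infix_flatten (T : eqType) (t : seq T) ss :
  t \in ss -> infix t (flatten ss).
Proof.
by case/splitPr=> l1 l2; rewrite flatten_cat /=; apply/infixP; exists (flatten l1), (flatten l2).
Qed.

(** At a successor node the blocks are filtered one by one and the empty ones dropped. Their number
    does not grow and the surviving minima do not decrease, so the Schreier condition persists. *)
Lemma hereditary_gschreier a : hereditary (gschreier a).
Proof.
elim: a => [|b IH|f IH] p s so /=.
- by move=> s1 _; apply: leq_trans s1; rewrite size_filter count_size.
- case=> ss [ssn0 [ne Fss sE _ hS]] fn0.
  exists [seq t <- [seq filter p t | t <- ss] | t != [::]].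
  have fE : filter p s = flatten [seq t <- [seq filter p t | t <- ss] | t != [::]].
    rewrite sE filter_flatten; elim: [seq filter p t | t <- ss] => //= t l ->.
    by case: t.
  have sot : forall t, t \in ss -> sorted ltn t.
    by move=> t tin; move: so; rewrite sE; apply/infix_sorted/infix_flatten.
  split; first by move: fn0; rewrite fE; case: (filter _ _).
  split=> //.
  + exact: filter_all.
  + move=> t; rewrite mem_filter => /andP [tn0 /mapP [t' t'in tE]].
    by rewrite tE in tn0 *; apply: IH => //; [exact: sot | exact: Fss].
  + exact: sorted_filter ltn_trans _ _ so.
  + move=> n /mapP [t]; rewrite mem_filter => /andP [tn0 /mapP [t' t'in tE]] ->.
    apply: (@leq_trans (head 0%N t')); last first.
      have := sot _ t'in; rewrite tE in tn0 *.
      case: t' {t'in tE} tn0 => //= x l; case: (p x) => //= tn0 px.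
      have : head 0%N (filter p l) \in filter p l by case: (filter p l) tn0 => //= *; rewrite inE eqxx.
      by rewrite mem_filter => /andP [_ hin]; have /allP/(_ _ hin)/ltnW := order_path_min ltn_trans px.
    apply: leq_trans (hS _ (map_f _ t'in)).
    by rewrite !size_map size_filter (leq_trans (count_size _ _)) // size_map.
- move=> [n [Fs big]] fn0; exists n; split; first exact: IH.
  by rewrite all_filter; apply: sub_all big => k /= ->; rewrite implybT.
Qed.

Lemma sumabs_ge0 (R : realType) s (x : nat -> R) : 0 <= sumabs s x.
Proof. exact: sumr_ge0. Qed.

Lemma sumabsD (R : realType) s (x y z : nat -> R) :
  (forall j, `|z j| <= `|x j| + `|y j|) -> sumabs s z <= sumabs s x + sumabs s y.
Proof. by move=> h; rewrite /sumabs -big_split /=; apply: ler_sum. Qed.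

Lemma sumabs_split (R : realType) (p : pred nat) s (x : nat -> R) :
  sumabs s x = sumabs (filter p s) x + sumabs (filter (predC p) s) x.
Proof. by rewrite /sumabs !big_filter (bigID p). Qed.

Lemma sumabs_init (R : realType) N s (x : nat -> R) : posset s ->
  all (fun n => n <= N)%N s -> sumabs s x <= sumabs (iota 1 N) x.
Proof.
move=> /andP [so /allP pos] /allP leN.
rewrite /sumabs; have -> : \sum_(n <- s) `|x n.-1| = \sum_(n <- iota 1 N | n \in s) `|x n.-1|.
  rewrite -[RHS]big_filter; apply: perm_big; apply: uniq_perm.
  - exact: (sorted_uniq ltn_trans ltnn).
  - by rewrite filter_uniq // iota_uniq.
  move=> n; rewrite mem_filter mem_iota; apply/esym/andb_idr => ns.
  by have := pos n ns; have := leN n ns; lia.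
by rewrite big_mkcond; apply: ler_sum => n _; case: ifP.
Qed.

Lemma normF_leP (R : realType) F (x : nat -> R) c : normF_le F x c <->
  0 <= c /\ forall s, norming F s -> sumabs s x <= c.
Proof.
split=> [[hs hF]|[c0 h]].
  have c0 : 0 <= c by apply: le_trans (hs 0%N).
  split=> // s [/andP [so pos] _ [Fs|]]; first exact: hF.
  by case: s {so pos} => [|n []] //= _; rewrite /sumabs big_seq1.
split=> [k|s so pos Fs].
  have := h [:: k.+1]; rewrite /sumabs big_seq1 /=; apply.
  by split => //; right.
case: (altP (s =P [::])) => [->|sn0]; first by rewrite big_nil.
by apply: h; split => //; [apply/andP | left].
Qed.

Definition tails_vanish (R : realType) F (x : nat -> R) : Prop :=
  forall e : R, 0 < e -> exists N, forall s, norming F s ->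
    all (ltn N) s -> sumabs s x <= e.

(** Truncations of [x] serve as finitely supported approximants, and heredity lets a norming set be
    cut down to its part beyond [N]. *)
Lemma tails_vanishP (R : realType) F (x : nat -> R) : hereditary F ->
  inX F x <-> tails_vanish F x.
Proof.
move=> hF; split=> h e e0.
  have [y [[N yN] /normF_leP [_ hn]]] := h e e0.
  exists N => s ns /allP big; apply: le_trans (hn s ns).
  rewrite /sumabs big_seq [leRHS]big_seq; apply: ler_sum => n ins.
  by rewrite yN ?subr0 //; have := big n ins; rewrite /=; lia.
(* The indices [k < N] store the coordinates of the integers [1, ..., N]. *)
have [N hN] := h e e0; exists (fun k => if (k < N)%N then x k else 0).
split; first by exists N => k kN; rewrite ltnNge kN.
apply/normF_leP; split=> [|s ns]; first exact: ltW.
rewrite (sumabs_split (fun n => n <= N)%N) [X in X + _]/sumabs big1_seq ?add0r; last first.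
  move=> n /andP [_]; rewrite mem_filter => /andP [nN ns'].
  case: ns => /andP [_ /allP /(_ n ns')] /= n0 _ _.
  by rewrite ifT ?subrr ?normr0 //; lia.
set s' := filter _ s; case: (altP (s' =P [::])) => [->|s'n0].
  by rewrite /sumabs big_nil ltW.
apply: (@le_trans _ _ (sumabs s' x)); last first.
  apply: hN; first exact: norming_filter.
  by apply/allP => n; rewrite mem_filter => /andP [/=]; rewrite -ltnNge.
rewrite /sumabs big_seq [leRHS]big_seq; apply: ler_sum => n.
by rewrite mem_filter => /andP [/= nN _]; rewrite ifF ?subr0 //; lia.
Qed.

Lemma tails_vanish_bounded (R : realType) F (x : nat -> R) : hereditary F ->
  tails_vanish F x -> exists C, normF_le F x C.
Proof.
move=> hF h; have [N hN] := h 1 ltr01.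
exists (sumabs (iota 1 N) x + 1); apply/normF_leP; split.
  by apply: addr_ge0 => //; exact: sumabs_ge0.
move=> s ns; rewrite (sumabs_split (fun n => n <= N)%N); apply: lerD.
  by apply: sumabs_init; [apply: posset_filter; case: ns | exact: filter_all].
set s' := filter _ s; case: (altP (s' =P [::])) => [->|s'n0].
  by rewrite /sumabs big_nil.
apply: hN; first exact: norming_filter.
by apply/allP => n; rewrite mem_filter => /andP [/=]; rewrite -ltnNge.
Qed.

Lemma cesaroB (R : realType) (u : nat -> nat -> R) phi k x j :
  cesaro u phi k j - x j = cesaro (fun n j => u n j - x j) phi k j.
Proof.
rewrite /cesaro sumrB sumr_const card_ord mulrBr -[x j *+ _]mulr_natl mulrA.
by rewrite mulVf ?mul1r // pnatr_eq0.
Qed.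

Lemma sumabs_sum (R : realType) s (I : Type) (r : seq I) (v : I -> nat -> R) :
  sumabs s (fun j => \sum_(i <- r) v i j) <= \sum_(i <- r) sumabs s (v i).
Proof.
rewrite /sumabs exchange_big /=; apply: ler_sum => n _; exact: ler_norm_sum.
Qed.

Lemma sumabsZ (R : realType) s c (v : nat -> R) :
  sumabs s (fun j => c * v j) = `|c| * sumabs s v.
Proof. by rewrite /sumabs mulr_sumr; apply: eq_bigr => n _; rewrite normrM. Qed.

(** * Free ultrafilters, means and Ptak's lemma *)

Definition free_ultra (U : set_system nat) : Prop :=
  UltraFilter U /\ forall N, U (fun n => N <= n)%N.

Lemma exists_free_ultra : exists U, free_ultra U.
Proof.
have [U [UU sub]] := ultraFilterLemma eventually_filter.
by exists U; split=> // N; apply: sub; exists N.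
Qed.

Lemma ultraN (U : set_system nat) (P : nat -> Prop) :
  UltraFilter U -> ~ U P -> U (fun n => ~ P n).
Proof. by move=> UU nP; case: (in_ultra_setVsetC P UU). Qed.

Lemma ultra_ord (U : set_system nat) (P : nat -> nat -> Prop) L :
  UltraFilter U -> (forall i, (i < L)%N -> U (P i)) ->
  U (fun n => forall i, (i < L)%N -> P i n).
Proof.
move=> UU; elim: L => [|L IH] h; first by apply: filterS filterT.
have h1 : U (fun n => forall i, (i < L)%N -> P i n).
  by apply: IH => i iL; apply: h; exact: ltnW.
apply: filterS2 h1 (h L (ltnSn L)) => n h1 h2 i.
by rewrite ltnS leq_eqVlt => /predU1P [-> //|]; exact: h1.
Qed.

Lemma increasing_ge (f : nat -> nat) : (forall i, (f i < f i.+1)%N) ->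
  (forall i j, (i < j)%N -> (f i < f j)%N) /\ forall i, (i <= f i)%N.
Proof.
move=> h; split; first exact: homo_ltn ltn_trans h.
by elim=> // i IH; apply: leq_ltn_trans (h i).
Qed.

(** Terms are chosen successively: each stage has to meet only finitely many [U]-large conditions,
    one for each earlier term. *)
Lemma ultra_pairwise (U : set_system nat) (D : nat -> Prop) (R : nat -> nat -> Prop) :
  free_ultra U -> U D -> (forall n, D n -> U (R n)) ->
  exists f : nat -> nat, [/\ forall i, (f i < f i.+1)%N, forall i, D (f i) &
    forall i j, (i < j)%N -> R (f i) (f j)].
Proof.
move=> [UU Uinf] UD UR.
(* Dependent choice runs on whole histories, since a new term must be related to all the earlier
   ones. *)
pose good (h : seq nat) := forall i, (i < size h)%N -> D (nth 0%N h i).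
pose next (h h' : seq nat) := exists n, [/\ h' = rcons h n,
  forall i, (i < size h)%N -> (nth 0%N h i < n)%N /\ R (nth 0%N h i) n & D n].
have step (x : {h | good h}) : exists y : {h | good h}, next (sval x) (sval y).
  case: x => h gh /=.
  have : U (fun n => D n /\ forall i, (i < size h)%N -> (nth 0%N h i < n)%N /\ R (nth 0%N h i) n).
    apply: filterI => //; apply: ultra_ord => i ih.
    by apply: filterI; [exact: Uinf | apply: UR; exact: gh].
  case/filter_ex => n [Dn hn].
  suff gr : good (rcons h n) by exists (exist _ (rcons h n) gr); exists n.
  move=> i; rewrite size_rcons nth_rcons ltnS leq_eqVlt => /predU1P [->|ih].
    by rewrite ltnn eqxx.
  by rewrite ih; exact: gh.
have [F [F0 FS]] := dependent_choice (fun x => cid (step x)) (exist good [::] (fun i (h : (i < 0)%N) => False_ind _ (elimF idP (ltn0 i) h))).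
pose H k := sval (F k).
have szH k : size (H k) = k.
  elim: k => [|k IH]; first by rewrite /H F0.
  by have [n [E _ _]] := FS k; rewrite /H E size_rcons -/(H k) IH.
pose f k := last 0%N (H k.+1).
have HS k : H k.+1 = rcons (H k) (f k).
  by have [n [E _ _]] := FS k; rewrite /f /H E last_rcons.
have nthH k i : (i < k)%N -> nth 0%N (H k) i = f i.
  elim: k => // k IH; rewrite HS nth_rcons szH ltnS leq_eqVlt => /predU1P [->|ik].
    by rewrite ltnn eqxx.
  by rewrite ik IH.
have key k : D (f k) /\ forall i, (i < k)%N -> (f i < f k)%N /\ R (f i) (f k).
  have [n [E hn Dn]] := FS k.
  have -> : f k = n by rewrite /f /H E last_rcons.
  split=> // i ik; rewrite -(nthH k i ik); apply: hn; by rewrite -/(H k) szH.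
exists f; split=> [i|i|i j ij].
- by case: (key i.+1) => _ /(_ i (ltnSn i)) [].
- by case: (key i).
- by case: (key j) => _ /(_ i ij) [].
Qed.

(** The limit is the supremum of the levels that [u] reaches for [U]-almost every index. *)
Lemma ultra_lim (R : realType) (U : set_system nat) (u : nat -> R) C :
  free_ultra U -> (forall n, `|u n| <= C) ->
  exists x, forall e, 0 < e -> U (fun n => `|u n - x| <= e).
Proof.
move=> [UU Uinf] bd.
pose E : set R := fun q => U (fun n => q <= u n).
have EC : E (- C).
  by apply: filterS filterT => n _; have := bd n; rewrite ler_norml => /andP [].
have ubC : ubound E C.
  move=> q Eq; have [n qn] := filter_ex Eq; apply: le_trans qn _.
  by have := bd n; rewrite ler_norml => /andP [].
have hs : has_sup E by split; [exists (- C) | exists C].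
exists (sup E) => e e0.
have [q Eq qs] := sup_adherent e0 hs.
have nE : U (fun n => ~ (sup E + e <= u n)).
  apply: ultraN => h; have := sup_upper_bound hs h; lra.
apply: filterS2 Eq nE => n h1 /negP; rewrite -ltNge => h2.
rewrite ler_norml; apply/andP; split; lra.
Qed.

(** A convex combination is encoded as an expectation, so that coordinates, seminorms and indicators
    of events can all be averaged. *)
Definition is_mean (R : realType) (T : Type) (A : T -> Prop) (E : (T -> R) -> R) : Prop :=
  exists (n : nat) (a : 'I_n -> T) (w : 'I_n -> R),
    [/\ (forall i, A (a i)), (forall i, 0 <= w i), \sum_i w i = 1 &
        E = fun f => \sum_i w i * f (a i)].

Section Mean.
Context (R : realType) (T : Type) (A : T -> Prop) (E : (T -> R) -> R).
Context (mE : is_mean A E).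

Lemma mean_le f g : (forall a, A a -> f a <= g a) -> E f <= E g.
Proof.
case: mE => n [a [w [Aa w0 _ ->]]] h; apply: ler_sum => i _.
by apply: ler_wpM2l => //; apply: h.
Qed.

Lemma mean_cst c : E (fun=> c) = c.
Proof. by case: mE => n [a [w [_ _ w1 ->]]]; rewrite -mulr_suml w1 mul1r. Qed.

Lemma meanD f g : E (fun a => f a + g a) = E f + E g.
Proof.
case: mE => n [a [w [_ _ _ ->]]]; rewrite -big_split /=.
by apply: eq_bigr => i _; rewrite mulrDr.
Qed.

Lemma meanZ c f : E (fun a => c * f a) = c * E f.
Proof.
case: mE => n [a [w [_ _ _ ->]]]; rewrite mulr_sumr.
by apply: eq_bigr => i _; rewrite mulrCA.
Qed.

Lemma mean_sum (I : Type) (r : seq I) (f : I -> T -> R) :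
  E (fun a => \sum_(i <- r) f i a) = \sum_(i <- r) E (f i).
Proof.
case: mE => n [a [w [_ _ _ ->]]]; rewrite exchange_big /=.
by apply: eq_bigr => i _; rewrite mulr_sumr.
Qed.

Lemma mean_gt f c : c < E f -> exists2 a, A a & c < f a.
Proof.
move=> h; apply: contrapT => /forall2NP no; move: h; apply/negP; rewrite -leNgt.
rewrite -[leRHS]mean_cst; apply: mean_le => a Aa.
by case: (no a) => // /negP; rewrite -leNgt.
Qed.

End Mean.

(** With [m] true values this reads [m <= 1 + m(m-1)/2]. Averaged, it bounds the total mass of
    events that are almost disjoint in pairs. *)
Lemma count_le_pairs (R : realType) (c : nat -> bool) L :
  \sum_(i < L) (c i)%:R <= 1 + \sum_(j < L) \sum_(i < j) (c i && c j)%:R :> R.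
Proof.
elim: L => [|L IH]; first by rewrite !big_ord0 addr0.
rewrite !big_ord_recr /=; case: (c L) => /=; last first.
  by rewrite addr0 [X in _ <= _ + (_ + X)]big1 ?addr0 // => i _; rewrite andbF.
rewrite [X in _ <= _ + (_ + X)](eq_bigr (fun i : 'I_L => (c i)%:R)) => [|i _]; last by rewrite andbT.
suff : 0 <= \sum_(j < L) \sum_(i < j) ((c i && c j)%:R : R) by lra.
by do 2 (apply: sumr_ge0 => ? _); rewrite ler0n.
Qed.

(* Ptak's combinatorial lemma, for means instead of a single measure: events that
   keep a fixed mass along the ultrafilter have a subfamily with the finite
   intersection property.  The invariant [P h] says that the events indexed by [h]
   meet almost every further event in a set of mass bounded below; if no index
   preserved it, many events of mass at least [eta] would be pairwise almost
   disjoint. *)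
Lemma ptak (R : realType) (T : Type) (A : T -> Prop) (U : set_system nat)
    (E : nat -> (T -> R) -> R) (B : nat -> T -> bool) (eta : R) :
  free_ultra U -> (forall n, is_mean A (E n)) -> 0 < eta ->
  (forall N, U (fun n => eta <= E n (fun a => (B N a)%:R))) ->
  exists g : nat -> nat, (forall j, (j <= g j)%N) /\
    forall J, exists2 a, A a & forall j, (j < J)%N -> B (g j) a.
Proof.
move=> UU mE eta0 hB; have [Uu Uinf] := UU.
pose C h a := all (B^~ a) h.
pose P h := exists2 d : R, 0 < d &
  U (fun N => U (fun n => d <= E n (fun a => (C h a && B N a)%:R))).
have P0 : P [::] by exists eta => //; apply: filterS filterT => N _; exact: hB.
have step h : P h -> exists N, (size h <= N)%N /\ P (N :: h).
  move=> [d d0 hd]; apply: contrapT => no.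
  have nP N : (size h <= N)%N -> ~ P (N :: h).
    by move=> hN PN; apply: no; exists N.
  pose D N := (size h <= N)%N /\ U (fun n => d <= E n (fun a => (C h a && B N a)%:R)).
  have UD : U D by apply: filterI.
  (* By [count_le_pairs], the masses of [L] events, each at least [d], will add up to at most 1 plus
     the masses of their pairwise intersections, hence to at most 2. *)
  have [L Ld] : exists L : nat, 2 < L%:R * d.
    exists (Num.truncn (2 / d)).+1; rewrite -ltr_pdivrMr //.
    by apply: truncnS_gt.
  have L0 : (0 < L)%N by case: L Ld => // ; rewrite mul0r; lra.
  (* There are fewer than [L^2] pairs, so together they contribute at most 1. *)
  pose d' : R := (L%:R ^+ 2)^-1.
  have d'0 : 0 < d' by rewrite invr_gt0 exprn_gt0 // ltr0n.
  pose Q N N' := U (fun n => E n (fun a => (C (N :: h) a && B N' a)%:R) < d').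
  have UQ N : D N -> U (Q N).
    move=> [hN _]; have h1 : U (fun N' => ~ U (fun n => d' <= E n (fun a => (C (N :: h) a && B N' a)%:R))).
      by apply: ultraN => h1; apply: (nP N hN); exists d'.
    by apply: filterS h1 => N' /(ultraN Uu); apply: filterS => n /negP; rewrite -ltNge.
  have [f [_ fD fQ]] := ultra_pairwise UU UD UQ.
  have h1 : U (fun n => forall i, (i < L)%N -> d <= E n (fun a => (C h a && B (f i) a)%:R)).
    by apply: ultra_ord => i _; case: (fD i).
  have h2 : U (fun n => forall j, (j < L)%N -> forall i, (i < j)%N ->
     E n (fun a => (C (f i :: h) a && B (f j) a)%:R) < d').
    apply: ultra_ord => j jL; apply: ultra_ord => i ij; exact: fQ.
  have [n [{}h1 {}h2]] := filter_ex (filterI h1 h2).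
  have key : \sum_(i < L) E n (fun a => (C h a && B (f i) a)%:R) <=
     1 + \sum_(j < L) \sum_(i < j) E n (fun a => (C (f i :: h) a && B (f j) a)%:R).
    under [X in _ <= _ + X]eq_bigr => j _ do rewrite -(mean_sum (mE n)).
    rewrite -!(mean_sum (mE n)) -[X in _ <= X + _](mean_cst (mE n)) -(meanD (mE n)).
    apply: (mean_le (mE n)) => a _.
    have := count_le_pairs R (fun i => C h a && B (f i) a) L.
    move/le_trans; apply; rewrite lerD2l; apply: ler_sum => j _; apply: ler_sum => i _.
    by rewrite /C /=; case: (B (f i) a); case: (B (f j) a); case: (all _ _).
  have k1 : L%:R * d <= \sum_(i < L) E n (fun a => (C h a && B (f i) a)%:R).
    rewrite mulr_natl -[X in _ *+ X]card_ord -sumr_const; apply: ler_sum => i _; exact: h1.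
  have k2 : \sum_(j < L) \sum_(i < j) E n (fun a => (C (f i :: h) a && B (f j) a)%:R) <= 1.
    apply: (@le_trans _ _ (\sum_(j < L) L%:R * d')); last first.
      rewrite sumr_const card_ord -[leLHS]mulr_natl mulrA -expr2 divff //.
      by rewrite expf_neq0 // pnatr_eq0 -lt0n.
    apply: ler_sum => j _; apply: (@le_trans _ _ (\sum_(i < j) d')).
      by apply: ler_sum => i _; apply/ltW/h2.
    by rewrite sumr_const card_ord -[leLHS]mulr_natl ler_pM2r // ler_nat ltnW.
  lra.
have step' (x : {h | P h}) : exists y : {h | P h},
    exists N, (size (sval x) <= N)%N /\ sval y = N :: sval x.
  case: x => h Ph /=; have [N [hN PN]] := step h Ph.
  by exists (exist _ _ PN), N.
have [F [F0 FS]] := dependent_choice (fun x => cid (step' x)) (exist P [::] P0).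
pose H k := sval (F k).
have szH k : size (H k) = k.
  elim: k => [|k IH]; first by rewrite /H F0.
  by have [N [_ E']] := FS k; rewrite /H E' /= -/(H k) IH.
pose g k := head 0%N (H k.+1).
have HS k : (k <= g k)%N /\ H k.+1 = g k :: H k.
  by have [N [leN E']] := FS k; rewrite /g /H E' /=; move: leN; rewrite -/(H k) szH.
exists g; split=> [j|J]; first by case: (HS j).
have [d d0 hd] := svalP (F J).
(* Positive mass in a single mean already produces a point of [A] lying in the first [J] events. *)
have [N hN] := filter_ex hd; have [n hn] := filter_ex hN.
have [a Aa ha] := mean_gt (mE n) (lt_le_trans d0 hn).
exists a => //; have {ha} : C (H J) a by move: ha; rewrite -/(H J); case: (C _ a); rewrite //= ltxx.
elim: J {d d0 hd N hN n hn} => // J IH; rewrite (HS J).2 /C /= => /andP [Bg CJ] j.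
by rewrite ltnS leq_eqVlt => /predU1P [-> //|]; exact: IH.
Qed.

(** * Cesaro means *)

Lemma ultra_sumabs (R : realType) (U : set_system nat) (v : nat -> nat -> R) :
  UltraFilter U -> (forall j e, 0 < e -> U (fun n => `|v n j| <= e)) ->
  forall s e, 0 < e -> U (fun n => sumabs s (v n) <= e).
Proof.
move=> UU h; elim=> [|p s IH] e e0.
  by apply: filterS filterT => n _; rewrite /sumabs big_nil ltW.
have e2 : 0 < e / 2 by lra.
apply: filterS2 (h p.-1 _ e2) (IH _ e2) => n h1 h2.
by rewrite /sumabs big_cons -/(sumabs s (v n)); lra.
Qed.

(** Each of the first [m] terms falls short of [q] by at most [C + q]. *)
Lemma sum_eventually_ge (R : realType) (g : nat -> R) m C q :
  (forall i, - C <= g i) -> (forall i, (m <= i)%N -> q <= g i) -> 0 <= C + q ->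
  forall K, K%:R * q - m%:R * (C + q) <= \sum_(i < K) g i.
Proof.
move=> gC gq Cq0 K; suff : K%:R * q - (minn K m)%:R * (C + q) <= \sum_(i < K) g i.
  apply: le_trans; rewrite lerD2l lerN2; apply: ler_wpM2r => //.
  by rewrite ler_nat geq_minr.
elim: K => [|K IH]; first by rewrite min0n big_ord0; lra.
rewrite big_ord_recr /=; have [mK|Km] := leqP m K.
  have -> : minn K.+1 m = minn K m by lia.
  by rewrite -natr1; have := gq K mK; nra.
have -> : minn K.+1 m = (minn K m).+1 by lia.
by rewrite -!natr1; have := gC K; nra.
Qed.

Lemma exists_natmul_ge (R : realType) (a b : R) : 0 < a -> exists N : nat,
  forall k, (N <= k)%N -> b <= k.+1%:R * a.
Proof.
move=> a0; exists (Num.truncn (b / a)) => k Nk.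
rewrite -ler_pdivrMr //; apply: ltW; apply: lt_le_trans (truncnS_gt _) _.
by rewrite ler_nat.
Qed.

Lemma cesaro_to0 (R : realType) (v : nat -> R) C : (forall i, `|v i| <= C) ->
  (forall e, 0 < e -> exists m, forall i, (m <= i)%N -> `|v i| <= e) ->
  forall e, 0 < e -> exists N, forall k, (N <= k)%N ->
    `|k.+1%:R^-1 * \sum_(i < k.+1) v i| <= e.
Proof.
move=> vC v0 e e0; have e2 : 0 < e / 2 by lra.
have [m hm] := v0 _ e2.
have C0 : 0 <= C by apply: le_trans (vC 0%N).
have [N hN] := exists_natmul_ge (m%:R * (C + e)) e2.
exists N => k Nk; have K0 : 0 < k.+1%:R :> R by rewrite ltr0n.
rewrite normrM gtr0_norm ?invr_gt0 // mulrC ler_pdivrMr // (le_trans (ler_norm_sum _ _ _)) //.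
(* [sum_eventually_ge] is applied to the negated absolute values. The slack [e] in the bound makes
   its last hypothesis hold even when [C] is smaller than [e / 2]. *)
have h1 i : - (C + e) <= - `|v i| by have := vC i; lra.
have h2 i : (m <= i)%N -> - (e / 2) <= - `|v i| by move=> mi; have := hm i mi; lra.
have h3 : 0 <= C + e + - (e / 2) by lra.
have := sum_eventually_ge h1 h2 h3 k.+1; rewrite sumrN.
have := hN k Nk; have : 0 <= m%:R :> R by rewrite ler0n.
by set S := \sum_(i < _) _; nra.
Qed.

Lemma half_expr_gt0 (R : realType) n : 0 < (2^-1 : R) ^+ n.
Proof. by rewrite exprn_gt0 // invr_gt0; lra. Qed.

Lemma geom_half_le2 (R : realType) K : \sum_(i < K) (2^-1 : R) ^+ i <= 2.
Proof.
suff : \sum_(i < K) (2^-1 : R) ^+ i <= 2 - 2 * 2^-1 ^+ K.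
  by have := half_expr_gt0 R K; lra.
elim: K => [|K IH]; first by rewrite big_ord0 expr0; lra.
by rewrite big_ord_recr /= exprS; lra.
Qed.

Lemma half_expr_le (R : realType) m n : (m <= n)%N -> (2^-1 : R) ^+ n <= 2^-1 ^+ m.
Proof. by move=> mn; apply: ler_wiXn2l => //; [rewrite invr_ge0; lra | lra]. Qed.

Lemma natmul_half_expr_le1 (R : realType) n : n%:R * (2^-1 : R) ^+ n <= 1.
Proof.
rewrite exprVn ler_pdivrMr ?exprn_gt0 ?ltr0n // mul1r -natrX ler_nat ltnW //.
exact: ltn_expl.
Qed.

Lemma half_expr_small (R : realType) (e : R) : 0 < e -> exists n, (2^-1 : R) ^+ n <= e.
Proof.
move=> e0; have [N hN] := exists_natmul_ge 1 e0; exists N.+1.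
have := natmul_half_expr_le1 R N.+1; have := hN N (leqnn N).
have : 0 < N.+1%:R :> R by rewrite ltr0n.
by set p := _ ^+ _; set q := _%:R; nra.
Qed.

(** A term is recovered from two consecutive Cesaro means, so convergence allows its norm to grow
    only like a fraction of its index; this excludes terms [u n] of norm above [n]. *)
Lemma banach_saks_bounded (R : realType) F (A : (nat -> R) -> Prop) : hereditary F ->
  banach_saks F A -> exists C, forall a, A a -> normF_le F a C.
Proof.
move=> hF bs; apply: contrapT => no.
have /choice [u hu] (n : nat) : exists a, A a /\ ~ normF_le F a n%:R.
  apply: contrapT => h; apply: no; exists n%:R => a Aa; apply: contrapT => h'.
  by apply: h; exists a.
have [phi [/increasing_ge [_ phi_ge] [y [Xy cv]]]] := bs u (fun k => (hu k).1).
have [Cy /normF_leP [Cy0 hCy]] := tails_vanish_bounded hF ((tails_vanishP _ hF).1 Xy).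
(* The two means cost [(2K + 3)/4] and [Cy] costs at most [(K + 1)/4], in total at most [K + 1]. *)
have q0 : 0 < 4^-1 :> R by rewrite invr_gt0; lra.
have [N hN] := cv _ q0.
have [N' hN'] := exists_natmul_ge (4 * Cy) (ltr01 : 0 < 1 :> R).
pose K := (N + N')%N.
have /normF_leP [_ c1] := hN K (leq_addr _ _).
have /normF_leP [_ c2] := hN K.+1 (leqW (leq_addr _ _)).
apply: (hu (phi K.+1)).2; apply/normF_leP; split=> // s ns.
have lin j : u (phi K.+1) j = K.+2%:R * (cesaro u phi K.+1 j - y j) - K.+1%:R * (cesaro u phi K j - y j) + y j.
  rewrite /cesaro !mulrBr !mulrA !divff ?pnatr_eq0 // !mul1r big_ord_recr /=.
  by rewrite -[K.+2%:R]natr1; ring.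
have h : sumabs s (u (phi K.+1)) <= K.+2%:R * sumabs s (fun j => cesaro u phi K.+1 j - y j)
    + (K.+1%:R * sumabs s (fun j => cesaro u phi K j - y j) + sumabs s y).
  rewrite -[X in X * sumabs s _ + _]normr_nat -[X in X * sumabs s _ + sumabs s y]normr_nat -!sumabsZ.
  rewrite addrA; apply: (@le_trans _ _ (sumabs s (fun j => K.+2%:R * (cesaro u phi K.+1 j - y j) - K.+1%:R * (cesaro u phi K j - y j)) + sumabs s y)).
    by apply: sumabsD => j; rewrite lin ler_normD.
  by rewrite lerD2r; apply: sumabsD => j; exact: ler_normB.
have h1 := ler_wpM2l (ler0n _ K.+1) (c1 s ns).
have h2 := ler_wpM2l (ler0n _ K.+2) (c2 s ns).
have := hCy s ns; have := hN' K (leq_addl _ _).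
have : K.+1%:R <= (phi K.+1)%:R :> R by rewrite ler_nat.
have : 1 <= K.+1%:R :> R by rewrite ler1n.
move: h h1 h2; rewrite -[K.+2%:R]natr1; lra.
Qed.

(** * Banach-Saks sets *)

(** On failure, [x] has mass above [e] on norming sets [s N] beyond every [N]. Ptak's lemma gives
    points [a J] large on the first [J] of certain such sets, so any subsequence of [a] is
    eventually large on each of them. *)
Lemma mean_limit_tails_vanish (R : realType) F (A : (nat -> R) -> Prop) C
    (U : set_system nat) (E : nat -> ((nat -> R) -> R) -> R) (x : nat -> R) :
  hereditary F -> banach_saks F A -> (forall a, A a -> normF_le F a C) ->
  free_ultra U -> (forall n, is_mean A (E n)) ->
  (forall j e, 0 < e -> U (fun n => `|E n (fun a => a j) - x j| <= e)) ->
  tails_vanish F x.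
Proof.
move=> hF bs bdA UU mE lim e e0; have [Uu _] := UU.
apply: contrapT => no.
have /choice [s hs] (N : nat) : exists s, [/\ norming F s, all (ltn N) s & e < sumabs s x].
  apply: contrapT => h; apply: no; exists N => s ns big; rewrite leNgt; apply/negP => lt.
  by apply: h; exists s.
(* This functional is dominated by [sumabs (s N)], agrees with it at [x], and commutes with means
   because it is linear. *)
pose f N (a : nat -> R) := \sum_(n <- s N) Num.sg (x n.-1) * a n.-1.
have f_le N a : `|f N a| <= sumabs (s N) a.
  apply: le_trans (ler_norm_sum _ _ _) _; apply: ler_sum => n _.
  rewrite normrM normr_sg; case: (_ != 0); rewrite ?mul1r // mul0r.
  exact: normr_ge0.
have fx N : f N x = sumabs (s N) x by apply: eq_bigr => n _; rewrite -normrEsg.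
have EC N a : A a -> `|f N a| <= C.
  move=> /bdA /normF_leP [_ h]; apply: le_trans (f_le N a) (h _ _).
  by case: (hs N).
have C0 : 0 <= C.
  have neg : -1 < E 0%N (fun=> 0) by rewrite (mean_cst (mE 0%N)); lra.
  by have [a Aa _] := mean_gt (mE 0%N) neg; exact: le_trans (normr_ge0 _) (EC 0%N a Aa).
pose B N a := e / 4 <= f N a.
(* A Markov estimate: [f N] has mean at least [e / 2], is below [e / 4] off [B N] and at most [C] on
   it. *)
pose eta := e / 4 / (C + 1).
have eta0 : 0 < eta by apply: divr_gt0; lra.
have hB N : U (fun n => eta <= E n (fun a => (B N a)%:R)).
  have e2 : 0 < e / 2 by lra.
  apply: filterS (ultra_sumabs Uu lim (s N) e2) => n hn.
  have Ef : E n (f N) = \sum_(p <- s N) Num.sg (x p.-1) * E n (fun a => a p.-1).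
    by rewrite (mean_sum (mE n)); apply: eq_bigr => p _; rewrite (meanZ (mE n)).
  have h1 : e / 2 <= E n (f N).
    have : `|E n (f N) - f N x| <= e / 2.
      apply: le_trans hn; rewrite Ef -sumrB; apply: le_trans (ler_norm_sum _ _ _) _.
      apply: ler_sum => p _; rewrite -mulrBr normrM normr_sg.
      by case: (_ != 0); rewrite ?mul1r // mul0r normr_ge0.
    by rewrite fx ler_norml => /andP [h _]; case: (hs N) => _ _; lra.
  have h2 : E n (f N) <= e / 4 + (C + 1) * E n (fun a => (B N a)%:R).
    rewrite -(meanZ (mE n)) -[X in X + _](mean_cst (mE n)) -(meanD (mE n)).
    apply: (mean_le (mE n)) => a Aa; have := EC N a Aa; rewrite ler_norml => /andP [_].
    rewrite /B; case: (leP (e / 4) (f N a)) => /=; lra.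
  rewrite /eta ler_pdivrMr; last by lra.
  lra.
have [g [gN hg]] := ptak UU mE eta0 hB.
have /choice [a ha] (J : nat) : exists a, A a /\ forall j, (j < J)%N -> B (g j) a.
  by have [a Aa h] := hg J; exists a.
have [phi [/increasing_ge [_ phi_ge] [y [Xy cv]]]] := bs a (fun k => (ha k).1).
have e32 : 0 < e / 32 by lra.
have [N hN] := (tails_vanishP _ hF).1 Xy _ e32.
have [N1 hN1] := cv _ e32.
(* A single functional beyond the tail index of [y] suffices: it is tiny at [y], yet at least
   [e / 4] at all but the first [N.+1] terms. *)
pose G := f (g N).
have Gn : norming F (s (g N)) by case: (hs (g N)).
have Gy : `|G y| <= e / 32.
  apply: le_trans (f_le _ _) (hN _ Gn _); case: (hs (g N)) => _ /allP big _.
  by apply/allP => p /big /=; apply: leq_ltn_trans.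
have e16 : 0 < e / 16 by lra.
have [N2 hN2] := exists_natmul_ge (N.+1%:R * (C + e / 4)) e16.
pose k := (N1 + N2)%N.
have /normF_leP [_ /(_ _ Gn) c1] := hN1 k (leq_addr _ _).
have Gc : `|G (fun j => cesaro a phi k j - y j)| <= e / 32 by apply: le_trans (f_le _ _) c1.
have GE : k.+1%:R * (G (fun j => cesaro a phi k j - y j) + G y) = \sum_(i < k.+1) G (a (phi i)).
  rewrite /G /f -big_split /= exchange_big /= mulr_sumr; apply: eq_bigr => p _.
  by rewrite -mulr_sumr /cesaro mulrBr subrK mulrCA mulVKf ?pnatr_eq0.
have g1 i : - C <= G (a (phi i)).
  by have := EC (g N) _ (ha (phi i)).1; rewrite ler_norml => /andP [].
have g2 i : (N.+1 <= i)%N -> e / 4 <= G (a (phi i)).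
  by move=> Ni; apply: (ha (phi i)).2; apply: leq_trans Ni _; exact: phi_ge.
have g3 : 0 <= C + e / 4 by lra.
have := sum_eventually_ge g1 g2 g3 k.+1; rewrite -GE.
have := hN2 k (leq_addl _ _); have : 0 < k.+1%:R :> R by rewrite ltr0n.
move: Gy Gc; rewrite !ler_norml => /andP [_ h1] /andP [_ h2].
move=> k0 h3 h4.
have : k.+1%:R * (G (fun j => cesaro a phi k j - y j) + G y) <= k.+1%:R * (e / 16).
  by rewrite ler_pM2l //; lra.
have := mulr_gt0 k0 e0; lra.
Qed.

(** * Blocks of mass escaping to infinity *)

Lemma posset_flatten (t : nat -> seq nat) m p :
  (forall k, posset (t k)) ->
  (forall k l, (k < l)%N -> allrel ltn (t k) (t l)) ->
  posset (flatten [seq t k | k <- iota m p]).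
Proof.
move=> pt hlt; apply/andP; split; last first.
  by apply/allP => n /flatten_mapP [k _]; have /andP [_ /allP] := pt k; apply.
rewrite (sorted_pairwise ltn_trans).
elim: p m => //= p IH m; rewrite pairwise_cat IH andbT.
have /andP [so _] := pt m; rewrite -(sorted_pairwise ltn_trans) so andbT.
apply/allrelP => a b am /flatten_mapP [k]; rewrite mem_iota => /andP [mk _] bk.
by have /allrelP := hlt m k mk; apply.
Qed.

Lemma sumabs_flatten (R : realType) (t : nat -> seq nat) (r : seq nat) (x : nat -> R) :
  sumabs (flatten [seq t k | k <- r]) x = \sum_(k <- r) sumabs (t k) x.
Proof. by rewrite /sumabs big_flatten big_map. Qed.

(** The threshold [n0] accounts for limit nodes: membership in [gschreier (f k)] is sure to give
    membership in [gschreier (BL f)] once all elements are at least [k.+2]. *)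
Definition absorbs (F G : family) : Prop := exists n0 : nat, forall s,
  posset s -> all (leq n0) s -> tensor G schreier s -> F s.

Lemma tensor_schreier1 G t : posset t -> t != [::] -> G t -> tensor G schreier t.
Proof.
move=> /andP [so /allP pos] tn0 Gt; exists [:: t]; split=> //; split => //=.
- by rewrite tn0.
- by move=> s; rewrite inE => /eqP ->.
- by rewrite cats0.
by move=> n; rewrite inE => /eqP ->; apply: pos; case: t tn0 {so Gt} => //= *; rewrite inE eqxx.
Qed.

(** A mean of [2m] terms keeps mass about [d / (2m)] on each of the last [m] blocks. The union of
    these lies beyond [m], hence in [F], and carries mass about [d / 2], whereas the Cesaro limit
    has vanishing tails. *)
Lemma banach_saks_no_spreading_blocks (R : realType) F G (A : (nat -> R) -> Prop) C (d : R) :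
  hereditary F -> absorbs F G -> banach_saks F A ->
  (forall a, A a -> tails_vanish F a) -> (forall a, A a -> normF_le F a C) -> 0 < d ->
  ~ (forall N, exists (a : nat -> R) (t : seq nat),
      [/\ A a, posset t, G t, all (ltn N) t & d < sumabs t a]).
Proof.
move=> hF [n0 hn0] bs tA bdA d0.
move=> /choice [a /choice [t hat]].
have [U UU] := exists_free_ultra; have [Uu Uinf] := UU.
have Aa n : A (a n) by case: (hat n).
have pt n : posset (t n) by case: (hat n).
have tn0 n : t n != [::].
  case: (hat n) => _ _ _ _; case: (t n) => //; rewrite /sumabs big_nil; lra.
have tbig n p : p \in t n -> (n < p)%N by case: (hat n) => _ _ _ /allP h _; exact: h.
have tF n : (n0 <= n)%N -> norming F (t n).
  move=> nn; split=> //; left; apply: hn0 => //.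
    by apply/allP => p /tbig; apply: leq_trans (leqW nn).
  by apply: tensor_schreier1 => //; case: (hat n).
have a_bd n j : `|a n j| <= C by case: (bdA _ (Aa n)).
have /choice [z hz] j : exists x, forall e, 0 < e -> U (fun n => `|a n j - x| <= e).
  by apply: (@ultra_lim _ _ (fun n => a n j) C UU) => n.
pose eta := d / 16; have eta0 : 0 < eta by rewrite /eta; lra.
pose M n := (n + \max_(p <- t n) p)%N.
have tM n p : p \in t n -> (p <= M n)%N.
  by move=> pt'; apply: leq_trans (leq_addl _ _); exact: leq_bigmax_seq.
(* A gliding hump: block [n'] follows block [n], [a n] is negligible on block [n'], and [a n'] is
   close to the coordinatewise limit up to the end of block [n]. *)
pose Rel n n' := [/\ (M n <= n')%N, sumabs (t n') (a n) <= eta * 2^-1 ^+ n &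
   sumabs (iota 1 (M n)) (fun j => a n' j - z j) <= eta * 2^-1 ^+ n].
have URel n : True -> U (Rel n).
  move=> _; have en0 : 0 < eta * 2^-1 ^+ n by apply: mulr_gt0 => //; exact: half_expr_gt0.
  have [N hN] := tA _ (Aa n) _ en0.
  have h2 : U (fun n' => sumabs (t n') (a n) <= eta * 2^-1 ^+ n).
    apply: filterS (Uinf (maxn N n0)) => n'; rewrite geq_max => /andP [Nn' nn'].
    by apply: hN; [exact: tF | apply/allP => p /tbig; exact: leq_ltn_trans].
  have h3 := ultra_sumabs Uu hz (iota 1 (M n)) en0.
  by apply: filterS3 (Uinf (M n)) h2 h3.
have [f [f_incr _ fR]] := ultra_pairwise UU (filterT : U (fun=> True)) URel.
have [phi [phi_incr [y [Xy cv]]]] := bs (fun k => a (f k)) (fun k => Aa (f k)).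
have [f_mono f_ge] := increasing_ge f_incr.
have [phi_mono phi_ge] := increasing_ge phi_incr.
pose h k := f (phi k).
have hR k l : (k < l)%N -> Rel (h k) (h l) by move=> kl; apply/fR/phi_mono.
have h_ge k : (k <= h k)%N by apply: leq_trans (phi_ge k) (f_ge _).
have hpow k : eta * 2^-1 ^+ (h k) <= eta * 2^-1 ^+ k.
  by rewrite ler_pM2l //; exact: half_expr_le.
have yz j : y j = z j.
  apply/eqP; rewrite -subr_eq0 -normr_le0; apply/ler_addgt0Pl => e e0; rewrite addr0.
  have e2 : 0 < e / 2 by lra.
  have small e' : 0 < e' -> exists m, forall i, (m <= i)%N -> `|a (h i) j - z j| <= e'.
    move=> e'0; have [n hn] := half_expr_small (divr_gt0 e'0 eta0).
    (* [j.+1] puts the coordinate inside the controlled initial interval, and [n] makes the error at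
       most [e']. *)
    exists (maxn j.+1 n).+1 => i; set l := maxn _ _ => li.
    have [_ _ h3] := hR _ _ li.
    apply: le_trans (_ : sumabs [:: j.+1] (fun j => a (h i) j - z j) <= _); first by rewrite /sumabs big_seq1.
    apply: (@le_trans _ _ (sumabs (iota 1 (M (h l))) (fun j => a (h i) j - z j))).
      apply: sumabs_init => //=; rewrite andbT.
      by apply: leq_trans (leq_addr _ _); apply: leq_trans (h_ge _); rewrite leq_maxl.
    apply: le_trans h3 (le_trans (hpow l) _); rewrite mulrC -ler_pdivlMr //.
    by apply: le_trans hn; apply: half_expr_le; rewrite leq_maxr.
  have bd i : `|a (h i) j - z j| <= C + `|z j|.
    by apply: le_trans (ler_normB _ _) _; rewrite lerD2r.
  have [N1 hN1] := cesaro_to0 bd small e2.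
  have [N2 hN2] := cv _ e2.
  have [h2 _] := hN2 (N1 + N2)%N (leq_addl _ _).
  have h1 : `|cesaro (fun k => a (f k)) phi (N1 + N2) j - z j| <= e / 2.
    by rewrite cesaroB; exact: hN1 (leq_addr _ _).
  move: h1 (h2 j); rewrite !ler_norml => /andP [? ?] /andP [? ?]; apply/andP; lra.
have e32 : 0 < d / 32 by lra.
have [N1 hN1] := (tails_vanishP _ hF).1 Xy _ e32.
have [N2 hN2] := cv _ e32.
have [m [mN1 mN2 mn0 mpos]] : exists m, [/\ N1 <= m, N2 <= m, n0 <= m & 0 < m]%N.
  by exists (N1 + N2 + n0).+1; split; lia.
(* The [m] blocks numbered [m] to [2m - 1] all lie beyond [m], so their minima form a Schreier
   set. *)
pose T := flatten [seq t (h k) | k <- iota m m].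
have Tbig p : p \in T -> (m < p)%N.
  case/flatten_mapP=> k; rewrite mem_iota => /andP [mk _] /tbig.
  by apply: leq_ltn_trans; apply: leq_trans mk (h_ge k).
have pT : posset T.
  apply: (@posset_flatten (fun k => t (h k))) => [k|k l kl]; first exact: pt.
  apply/allrelP => p q /tM ph /tbig; apply: leq_ltn_trans; apply: leq_trans ph _.
  by case: (hR k l kl).
have nT : norming F T.
  split=> //.
    by rewrite /T; case: (m) mpos => // q _ /=; case: (t _) (tn0 (h q.+1)).
  left; apply: hn0 => //.
    by apply/allP => p /Tbig /=; lia.
  exists [seq t (h k) | k <- iota m m]; split.
    by rewrite -size_eq0 size_map size_iota -lt0n.
  split=> //.
  - by apply/allP => s /mapP [k _ ->].
  - by move=> s /mapP [k _ ->]; case: (hat (h k)).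
  - by case/andP: pT.
  move=> p; rewrite -map_comp => /mapP [k kin ->]; rewrite !size_map size_iota ltnW //=.
  apply: Tbig; apply/flatten_mapP; exists k => //.
  by case: (t (h k)) (tn0 (h k)) => //= *; rewrite inE eqxx.
pose K := (2 * m)%N.
pose c := cesaro (fun k => a (f k)) phi K.-1.
have cK j : K%:R * c j = \sum_(l < K) a (h l) j.
  by rewrite /c /cesaro prednK ?muln_gt0 // mulVKf // pnatr_eq0 -lt0n muln_gt0.
have Ty : sumabs T y <= d / 32.
  by apply: hN1 => //; apply/allP => p /Tbig; rewrite /=; lia.
have Tc : sumabs T (fun j => c j - y j) <= d / 32.
  have /normF_leP [_ hh] : normF_le F (fun j => c j - y j) (d / 32).
    by apply: hN2; rewrite /K; lia.
  exact: hh.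
(* On block [k], earlier terms are pure error, while later ones are the limit plus an error. *)
pose err k l j := if (l < k)%N then a (h l) j else if (k < l)%N then a (h l) j - z j else 0.
have err_le k l : (m <= k)%N -> sumabs (t (h k)) (err k l) <= eta * 2^-1 ^+ l + eta * 2^-1 ^+ m.
  move=> mk; have p1 := half_expr_gt0 R l; have p2 := half_expr_gt0 R m.
  have q1 := mulr_gt0 eta0 p1; have q2 := mulr_gt0 eta0 p2.
  rewrite /err; case: (ltngtP l k) => lk.
  - have [_ h2 _] := hR _ _ lk; have := hpow l; lra.
  - have [_ _ h3] := hR _ _ lk; have := hpow k.
    have : sumabs (t (h k)) (fun j => a (h l) j - z j) <=
      sumabs (iota 1 (M (h k))) (fun j => a (h l) j - z j).
      by apply: sumabs_init => //; apply/allP => p; exact: tM.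
    have := half_expr_le R mk; rewrite -(ler_pM2l eta0); lra.
  by rewrite /sumabs big1 => [|? _]; [lra | rewrite normr0].
have blk k : (m <= k < K)%N ->
    d <= K%:R * (sumabs (t (h k)) c + sumabs (t (h k)) y) + 4 * eta.
  move=> /andP [mk kK].
  have h1 : sumabs (t (h k)) (a (h k)) <= K%:R * sumabs (t (h k)) c +
     (K%:R * sumabs (t (h k)) y + \sum_(l < K) sumabs (t (h k)) (err k l)).
    apply: (@le_trans _ _ (sumabs (t (h k)) (fun j => K%:R * c j) +
      (sumabs (t (h k)) (fun j => K%:R * y j) + sumabs (t (h k)) (fun j => \sum_(l < K) err k l j)))); last first.
      by rewrite !sumabsZ !normr_nat !lerD2l sumabs_sum.
    apply: le_trans (_ : _ <= sumabs (t (h k)) (fun j => K%:R * c j) +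
      sumabs (t (h k)) (fun j => `|K%:R * y j| + `|\sum_(l < K) err k l j|)) _.
      apply: sumabsD => j; rewrite cK [in X in _ <= _ + X]ger0_norm ?addr_ge0 //.
      have split_k : a (h k) j = \sum_(l < K) a (h l) j - (\sum_(l < K) (k < l)%N%:R * y j + \sum_(l < K) err k l j).
        rewrite -big_split -sumrB /= (bigD1 (Ordinal kK)) //= big1 => [|l].
          by rewrite /err ltnn mulr0n; ring.
        rewrite -val_eqE /= /err yz; case: (ltngtP l k) => //= _ _; rewrite ?mulr0n ?mulr1n; ring.
      rewrite {1}split_k; apply: le_trans (ler_normB _ _) _; rewrite lerD2l.
      apply: le_trans (ler_normD _ _) _; rewrite lerD2r -mulr_suml !normrM normr_nat.
      apply: ler_wpM2r => //; apply: le_trans (ler_norm_sum _ _ _) _.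
      apply: le_trans (_ : _ <= \sum_(l < K) 1) _; last by rewrite sumr_const card_ord.
      by apply: ler_sum => l _; case: (_ < _)%N; rewrite ?normr1 ?normr0.
    by rewrite lerD2l; apply: sumabsD => j; rewrite ger0_norm ?addr_ge0.
  have h2 : \sum_(l < K) sumabs (t (h k)) (err k l) <= 4 * eta.
    apply: le_trans (_ : _ <= \sum_(l < K) (eta * 2^-1 ^+ l + eta * 2^-1 ^+ m)) _.
      by apply: ler_sum => l _; exact: err_le.
    rewrite big_split /= -mulr_sumr sumr_const card_ord -[_ *+ K]mulr_natl.
    have := ler_wpM2l (ltW eta0) (geom_half_le2 R K).
    have := ler_wpM2l (ltW eta0) (natmul_half_expr_le1 R m).
    rewrite /K natrM; lra.
  have [_ _ _ _ big] := hat (h k); lra.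
have tot : m%:R * d <= K%:R * (sumabs T c + sumabs T y) + m%:R * (4 * eta).
  rewrite /T !sumabs_flatten -big_split /= mulr_sumr.
  have -> : m%:R * (4 * eta) = \sum_(k <- iota m m) (4 * eta).
    by rewrite big_const_seq count_predT size_iota iter_addr_0 mulr_natl.
  have -> : m%:R * d = \sum_(k <- iota m m) d.
    by rewrite big_const_seq count_predT size_iota iter_addr_0 mulr_natl.
  rewrite -big_split /= big_seq [leRHS]big_seq; apply: ler_sum => k.
  by rewrite mem_iota addnn -mul2n; exact: blk.
have Tc' : sumabs T c <= sumabs T (fun j => c j - y j) + sumabs T y.
  by apply: sumabsD => j; rewrite -{1}[c j](subrK (y j)) ler_normD.
have m0 : 0 < m%:R :> R by rewrite ltr0n.
(* Cancelling [m] leaves [d <= 2 (d/16 + d/32) + d/4], which is impossible. *)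
have : m%:R * d <= m%:R * (2 * (sumabs T c + sumabs T y) + 4 * eta).
  by move: tot; rewrite /K natrM; lra.
rewrite ler_pM2l // /eta; lra.
Qed.

(** * Smallness of means minus their coordinatewise limit *)

Lemma sumabs_mean_le (R : realType) (A : (nat -> R) -> Prop) E s (u : nat -> R) :
  is_mean A E -> (forall j, u j = E (fun a => a j)) -> sumabs s u <= E (sumabs s).
Proof.
case=> n [a [w [_ w0 _ ->]]] uE.
have -> : u = fun j => \sum_i w i * a i j by apply/funext => j; rewrite uE.
apply: le_trans (sumabs_sum _ _ (fun i j => w i * a i j)) _.
by apply: ler_sum => i _; rewrite sumabsZ ger0_norm.
Qed.

(** Otherwise some mean, close to [x] on a long initial interval, differs from [x] by more than [e]
    on a set of [G]. Its part beyond that interval carries mass above [e / 2] of the mean, hence of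
    a point of [A], against [banach_saks_no_spreading_blocks]. *)
Lemma mean_uniformly_null (R : realType) F G (A : (nat -> R) -> Prop) C
    (U : set_system nat) (E : nat -> ((nat -> R) -> R) -> R) (u : nat -> nat -> R) (x : nat -> R) :
  hereditary F -> hereditary G -> absorbs F G -> banach_saks F A ->
  (forall a, A a -> tails_vanish F a) -> (forall a, A a -> normF_le F a C) ->
  UltraFilter U -> (forall n, is_mean A (E n)) ->
  (forall n j, u n j = E n (fun a => a j)) ->
  (forall j e, 0 < e -> U (fun n => `|u n j - x j| <= e)) -> tails_vanish F x ->
  forall e, 0 < e -> U (fun n => forall s, posset s -> G s ->
    sumabs s (fun j => u n j - x j) <= e).
Proof.
move=> hF hG abs bs tA bdA Uu mE uE lim tx e e0; apply: contrapT => /(ultraN Uu) bad.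
have e2 : 0 < e / 2 by lra.
apply: (banach_saks_no_spreading_blocks hF abs bs tA bdA e2) => N0.
have [n0 hn0] := abs.
have e4 : 0 < e / 4 by lra.
have [N1 hN1] := tx _ e4.
have [N [N0N N1N n0N]] : exists N, [/\ N0 <= N, N1 <= N & n0 <= N]%N.
  by exists (N0 + N1 + n0)%N; split; lia.
have [n [nbad ninit]] := filter_ex (filterI bad (ultra_sumabs Uu lim (iota 1 N) e4)).
have [s [ps Gs hs]] : exists s, [/\ posset s, G s & e < sumabs s (fun j => u n j - x j)].
  apply: contrapT => h; apply: nbad => s ps Gs; rewrite leNgt; apply/negP => hs.
  by apply: h; exists s.
pose t := [seq p <- s | (N < p)%N].
have pt : posset t by exact: posset_filter.
have tN p : p \in t -> (N < p)%N by rewrite mem_filter => /andP [].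
have h1 : e - e / 4 < sumabs t (fun j => u n j - x j).
  have : sumabs [seq p <- s | predC (fun p => N < p)%N p] (fun j => u n j - x j) <= e / 4.
    apply: le_trans ninit; apply: sumabs_init; first exact: posset_filter.
    by apply/allP => p; rewrite mem_filter /= -leqNgt => /andP [].
  by move: hs; rewrite (sumabs_split (fun p => N < p)%N) -/t; lra.
have tn0 : t != [::] by apply/eqP => t0; move: h1; rewrite t0 /sumabs big_nil; lra.
have Gt : G t by apply: hG => //; case/andP: ps.
have nt : norming F t.
  split=> //; left; apply: hn0 => //; last exact: tensor_schreier1.
  by apply/allP => p /tN /ltnW; exact: leq_trans.
have h2 : sumabs t x <= e / 4 by apply: hN1 => //; apply/allP => p /tN; exact: leq_ltn_trans.
have h3 : sumabs t (fun j => u n j - x j) <= sumabs t (u n) + sumabs t x.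
  by apply: sumabsD => j; exact: ler_normB.
have h4 : e / 2 < E n (sumabs t).
  by apply: lt_le_trans (sumabs_mean_le t (mE n) (uE n)); lra.
have [a Aa ha] := mean_gt (mE n) h4.
by exists a, t; split => //; apply/allP => p /tN; exact: leq_ltn_trans.
Qed.

(** Unlike inclusion, this relation passes from a limit node to every term of its fundamental
    sequence, with a larger [n0], as the induction on trees requires. *)
Definition eventually_sub (F G : family) : Prop := exists n0 : nat, forall s,
  posset s -> s != [::] -> all (leq n0) s -> G s -> F s.

(* A member of [S_(b+1)] with minimum at most [M] is a union of at most [M]
   members of [S_b], so smallness in the norm of [S_b] suffices; at a limit node
   such a set belongs to one of finitely many lower families. *)
Lemma mean_null_bounded_min (R : realType) F (A : (nat -> R) -> Prop) C
    (U : set_system nat) (E : nat -> ((nat -> R) -> R) -> R) (u : nat -> nat -> R) (x : nat -> R) b :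
  hereditary F -> banach_saks F A ->
  (forall a, A a -> tails_vanish F a) -> (forall a, A a -> normF_le F a C) ->
  UltraFilter U -> (forall n, is_mean A (E n)) ->
  (forall n j, u n j = E n (fun a => a j)) ->
  (forall j e, 0 < e -> U (fun n => `|u n j - x j| <= e)) -> tails_vanish F x ->
  eventually_sub F (gschreier b) ->
  forall M e, 0 < e -> U (fun n => forall s, posset s -> s != [::] -> gschreier b s ->
    (head 0 s <= M)%N -> sumabs s (fun j => u n j - x j) <= e).
Proof.
move=> hF bs tA bdA Uu mE uE lim tx; elim: b => [|b _|f IH] sub M e e0.
- apply: filterS (ultra_sumabs Uu lim (iota 1 M) e0) => n hn s ps sn0 Ss hM.
  apply: le_trans hn; apply: sumabs_init => //.
  by case: s {ps sn0} Ss hM => [|p []] //= _ ->.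
- have abs : absorbs F (gschreier b).
    case: sub => n0 hn0; exists n0 => s ps big ts; apply: hn0 => //.
    case: ts => -[|t ss] [] //= _ [/andP [tn0 _] _ -> _ _].
    by case: t tn0.
  (* At most [M] blocks contribute; [M.+1] keeps the tolerance positive when [M] is 0. *)
  have eM : 0 < e / M.+1%:R by apply: divr_gt0 => //; rewrite ltr0n.
  have hb := mean_uniformly_null hF (@hereditary_gschreier b) abs bs tA bdA Uu mE uE lim tx eM.
  apply: filterS hb => n hn s ps sn0 [ss [ssn0 [ne bss sE so hS]]] hM.
  have sz : (size ss <= M)%N.
    rewrite -(size_map (head 0%N)); apply: leq_trans hM; apply: hS.
    rewrite sE; case: ss {sE bss} ssn0 ne => //= t ss _ /andP [].
    by case: t => //= p t _ _; rewrite inE eqxx.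
  rewrite sE; apply: (@le_trans _ _ (\sum_(t <- ss) (e / M.+1%:R))).
    rewrite /sumabs big_flatten /= big_seq [leRHS]big_seq; apply: ler_sum => t tss.
    apply: hn; last exact: bss.
    have it : infix t s by rewrite sE; exact: infix_flatten.
    apply/andP; split; first exact: infix_sorted it so.
    by apply/allP => p /(mem_infix it); case/andP: ps => _ /allP; apply.
  rewrite big_const_seq count_predT iter_addr_0 -[leLHS]mulr_natr -mulrA ger_pMr //.
  by rewrite mulrC ler_pdivrMr ?ltr0n // mul1r ler_nat leqW.
- have subn k : eventually_sub F (gschreier (f k)).
    case: sub => n0 hn0; exists (n0 + k.+2)%N => s ps sn0 /allP big Ss; apply: hn0 => //.
      by apply/allP => p /big /=; lia.
    by exists k; split=> //; apply/allP => p /big /=; lia.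
  (* A set using the term [f k] has minimum at least [k.+2], so a minimum at most [M] forces
     [k < M]. *)
  have h : U (fun n => forall k, (k < M)%N -> forall s, posset s -> s != [::] ->
      gschreier (f k) s -> (head 0 s <= M)%N -> sumabs s (fun j => u n j - x j) <= e).
    by apply: ultra_ord => k _; exact: IH.
  apply: filterS h => n hn s ps sn0 [k [Ss /allP big]] hM; apply: (hn k) => //.
  have : head 0%N s \in s by case: s sn0 {ps Ss big hM} => //= *; rewrite inE eqxx.
  by move/big => /=; lia.
Qed.

(** * Convergent Cesaro means in the convex hull *)

Lemma sum_one_jump_le (R : realType) (g : nat -> R) (b : nat -> bool) C :
  0 <= C -> (forall i, g i <= C) -> (forall i, b i -> b i.+1) ->
  (forall i, ~~ b i -> g i <= 2^-1 ^+ i) ->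
  (forall i, b i -> g i.+1 <= 2^-1 ^+ i) ->
  forall K, \sum_(i < K) g i <= C + 6.
Proof.
move=> C0 gC bm g1 g2 K.
(* Only the term at which [b] first holds needs the bound [C]; [C *+ b n] charges it once, and a
   geometric series dominates the rest. *)
have h n : \sum_(i < n.+1) g i <= C *+ b n + 3 * \sum_(i < n.+1) 2^-1 ^+ i.
  elim: n => [|n IH].
    rewrite !big_ord_recr !big_ord0 /= !add0r expr0; have := gC 0%N; have := g1 0%N.
    rewrite expr0; case: (b 0%N) => /= [_|/(_ isT)]; rewrite ?mulr0n ?mulr1n; lra.
  rewrite big_ord_recr [X in _ <= _ + 3 * X]big_ord_recr /=; have p0 := half_expr_gt0 R n.
  have := gC n.+1; have := g1 n.+1; have := g2 n; have := bm n; move: IH; rewrite exprS.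
  set S := \sum_(i < _) _; set S' := \sum_(i < _) _.
  case: (b n) => [IH /(_ isT) -> /(_ isT)|IH _ _].
    by rewrite mulr1n in IH *; lra.
  case: (b n.+1) => /= [_|/(_ isT)]; rewrite ?mulr0n ?mulr1n in IH *; lra.
case: K => [|n]; first by rewrite big_ord0; lra.
have := h n; have := geom_half_le2 R n.+1.
by case: (b n); rewrite ?mulr0n ?mulr1n; lra.
Qed.

Lemma normF_le_mean (R : realType) F (A : (nat -> R) -> Prop) C E (u : nat -> R) :
  (forall a, A a -> normF_le F a C) -> is_mean A E ->
  (forall j, u j = E (fun a => a j)) -> normF_le F u C.
Proof.
move=> bdA mE uE.
have C0 : 0 <= C.
  have neg : -1 < E (fun=> 0) by rewrite (mean_cst mE); lra.
  by have [a /bdA /normF_leP []] := mean_gt mE neg.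
apply/normF_leP; split=> // s ns; apply: le_trans (sumabs_mean_le s mE uE) _.
rewrite -[leRHS](mean_cst mE); apply: (mean_le mE) => a /bdA /normF_leP [_]; exact.
Qed.

Lemma tails_vanish_mean (R : realType) F (A : (nat -> R) -> Prop) E (u : nat -> R) :
  (forall a, A a -> tails_vanish F a) -> is_mean A E ->
  (forall j, u j = E (fun a => a j)) -> tails_vanish F u.
Proof.
move=> tA mE uE e e0; have [n [a [w [Aa w0 w1 EE]]]] := mE.
have /choice [N hN] i := tA _ (Aa i) e e0.
exists (\max_i N i) => s ns /allP big; apply: le_trans (sumabs_mean_le s mE uE) _.
rewrite EE -[leRHS]mul1r -w1 mulr_suml; apply: ler_sum => i _; apply: ler_wpM2l => //.
apply: hN => //; apply/allP => p /big /=; apply: leq_ltn_trans; exact: leq_bigmax.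
Qed.

Lemma tails_vanishB (R : realType) F (x y : nat -> R) :
  tails_vanish F x -> tails_vanish F y -> tails_vanish F (fun j => x j - y j).
Proof.
move=> tx ty e e0; have e2 : 0 < e / 2 by lra.
have [N1 h1] := tx _ e2; have [N2 h2] := ty _ e2.
exists (maxn N1 N2) => s ns /allP big.
have := h1 s ns; have := h2 s ns.
have -> : all (ltn N2) s by apply/allP => p /big /=; rewrite gtn_max => /andP [].
have -> : all (ltn N1) s by apply/allP => p /big /=; rewrite gtn_max => /andP [].
move=> /(_ isT) {}h2 /(_ isT) {}h1; have : sumabs s (fun j => x j - y j) <= sumabs s x + sumabs s y.
  by apply: sumabsD => j; exact: ler_normB.
lra.
Qed.

Theorem theorem3p5 (R : realType) (alpha : bord) (A : (nat -> R) -> Prop) :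
  valid_bord alpha ->
  (forall x, A x -> inX (gschreier alpha) x) ->
  banach_saks (gschreier alpha) A <-> banach_saks (gschreier alpha) (conv A).
Proof.
move=> _ AX; set F := gschreier alpha in AX *.
have hF : hereditary F by exact: hereditary_gschreier.
split=> bs; last first.
  move=> u Au; apply: bs => k; exists 1%N, (fun=> u k), (fun=> 1).
  split=> // [|]; first by rewrite big_ord1.
  by apply/funext => j; rewrite big_ord1 mul1r.
have tA a : A a -> tails_vanish F a by move=> /AX /(tails_vanishP _ hF).
have [C bdA] := banach_saks_bounded hF bs.
move=> u Au.
have [U UU] := exists_free_ultra; have [Uu Uinf] := UU.
have /choice [E hE] n : exists E, is_mean A E /\ forall j, u n j = E (fun a => a j).
  have [k [a [w [Aa w0 w1 ->]]]] := Au n.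
  by exists (fun f => \sum_i w i * f (a i)); split=> //; exists k, a, w.
have mE n : is_mean A (E n) by case: (hE n).
have uE n j : u n j = E n (fun a => a j) by case: (hE n).
have u_bd n : normF_le F (u n) C := normF_le_mean bdA (mE n) (uE n).
have /choice [x lim] j : exists x, forall e, 0 < e -> U (fun n => `|u n j - x| <= e).
  by apply: (@ultra_lim _ _ (fun n => u n j) C UU) => n; case: (u_bd n).
have tx : tails_vanish F x.
  apply: (mean_limit_tails_vanish hF bs bdA UU mE) => j e e0.
  by apply: filterS (lim j e e0) => n; rewrite uE.
have [Cx /normF_leP [Cx0 x_bd]] := tails_vanish_bounded hF tx.
pose v n j := u n j - x j.
have [C0 _] := (normF_leP _ _ _).1 (u_bd 0%N).
have v_bd n s : norming F s -> sumabs s (v n) <= C + Cx.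
  move=> ns; apply: (@le_trans _ _ (sumabs s (u n) + sumabs s x)).
    by apply: sumabsD => j; exact: ler_normB.
  by apply: lerD; [case/normF_leP: (u_bd n) => _; apply | exact: x_bd].
have /choice [M hM] n : exists N, forall s, norming F s -> all (ltn N) s ->
    sumabs s (v n) <= 2^-1 ^+ n.
  apply: tails_vanishB (half_expr_gt0 R n) => //.
  exact: tails_vanish_mean tA (mE n) (uE n).
(* The running maximum makes the condition [head 0 s <= M' (f i)] persist as [i] grows. *)
pose M' n := \max_(i < n.+1) M i.
have M'_mono m n : (m <= n)%N -> (M' m <= M' n)%N.
  move=> mn; apply/bigmax_leqP => i _.
  exact: (@leq_bigmax_cond _ xpredT (fun i : 'I_n.+1 => M i) (widen_ord (mn : m.+1 <= n.+1)%N i)).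
pose Rel n n' := forall s, norming F s -> (head 0 s <= M' n)%N ->
  sumabs s (v n') <= 2^-1 ^+ n.
have URel n : True -> U (Rel n).
  move=> _; have p0 := half_expr_gt0 R n.
  have sub : eventually_sub F (gschreier alpha) by exists 0%N.
  have h1 := mean_null_bounded_min hF bs tA bdA Uu mE uE lim tx sub (M' n) p0.
  have h2 := ultra_sumabs Uu lim (iota 1 (M' n)) p0.
  apply: filterS2 h1 h2 => n' h1 h2 s [ps sn0 Fs] hs.
  (* A norming singleton may lie outside [F]; it is then contained in [[1, M' n]]. *)
  case: Fs => [Fs|s1]; first exact: h1.
  apply: le_trans h2; apply: sumabs_init => //.
  by case: s s1 hs {ps sn0} => [|p []] //= _ ->.
have [f [f_incr _ fR]] := ultra_pairwise UU (filterT : U (fun=> True)) URel.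
have [f_mono f_ge] := increasing_ge f_incr.
exists f; split=> //; exists x; split; first exact/(tails_vanishP _ hF).
move=> e e0; have [N hN] := exists_natmul_ge (C + Cx + 6) e0.
exists N => k Nk; apply/normF_leP; split=> [|s ns]; first exact: ltW.
have -> : (fun j => cesaro u f k j - x j) = (fun j => k.+1%:R^-1 * \sum_(i < k.+1) v (f i) j).
  by apply/funext => j; rewrite cesaroB.
rewrite sumabsZ ger0_norm ?invr_ge0 // mulrC ler_pdivrMr ?ltr0n // mulrC.
apply: le_trans (hN k Nk); apply: le_trans (sumabs_sum _ _ _) _.
(* While [s] starts beyond [M' (f i)] it meets only the small tail of [v (f i)]; once it starts
   earlier, [Rel] makes all later terms small on it. One term remains, bounded by [C + Cx]. *)
apply: (@sum_one_jump_le _ (fun i => sumabs s (v (f i))) (fun i => head 0 s <= M' (f i))%N).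
- exact: addr_ge0.
- by move=> i; exact: v_bd.
- by move=> i hi; apply: leq_trans hi (M'_mono _ _ _); exact: ltnW.
- move=> i; rewrite -ltnNge => hi; apply: le_trans (half_expr_le R (f_ge i)).
  apply: hM => //; apply/allP => p ps /=.
  have Mf : (M (f i) <= M' (f i))%N by exact: (@leq_bigmax_cond _ xpredT (fun i : 'I_(f i).+1 => M i) ord_max).
  apply: leq_ltn_trans Mf (leq_trans hi _).
  case: ns => /andP [so _] _ _; case: s {hi} so ps => //= q s so.
  rewrite inE => /predU1P [-> //|ps].
  by have /allP /(_ p ps) /ltnW := order_path_min ltn_trans so.
- move=> i hi; apply: le_trans (half_expr_le R (f_ge i)); exact: fR.
Qed.
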